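(* Let $T:V\to L$ be an $\mathcal{O}$-operator on a LieRep pair $(L,[\cdot,\cdot];\rho)$, with $\rho:L\to End(V)$. Then $T$ is also an $\mathcal{O}$-operator on the L.t.sRep pair $(L,[\cdot,\cdot,\cdot];\theta_\rho)$, where $[x,y,z]=[[x,y],z]$ and $\theta_\rho(x,y)=\rho(y)\rho(x)$.
   Context: All vector spaces are over a field of characteristic $0$. A LieRep pair $(L,[\cdot,\cdot];\rho)$ is a Lie algebra $L$ together with a representation $\rho:L\to End(V)$ on a vector space $V$. A linear map $T:V\to L$ is an $\mathcal{O}$-operator on the LieRep pair if $[Tu,Tv]=T\big(\rho(Tu)v-\rho(Tv)u\big)$ for all $u,v\in V$. With $[x,y,z]=[[x,y],z]$, $L$ is a Lie triple system (the bracket is trilinear, skew-symmetric in the first two arguments, and satisfies $[x,y,z]+[y,z,x]+[z,x,y]=0$ and $[x,y,[z,t,e]]=[[x,y,z],t,e]+[z,[x,y,t],e]+[z,t,[x,y,e]]$), and $\theta_\rho$ is a representation of this Lie triple system on $V$ (the pair is called a L.t.sRep pair). For a L.t.sRep pair $(L,[\cdot,\cdot,\cdot];\theta)$ put $D(x,y)=\theta(y,x)-\theta(x,y)$; a linear map $T:V\to L$ is an $\mathcal{O}$-operator on it if $[Tu,Tv,Tw]=T\big(D(Tu,Tv)w+\theta(Tv,Tw)u-\theta(Tu,Tw)v\big)$ for all $u,v,w\in V$. *)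

(* Defs.v *)
(* Vector spaces over K are arbitrary, possibly infinite-dimensional, lmodTypes. *)
From mathcomp Require Import all_boot all_algebra.
Set Implicit Arguments.
Unset Strict Implicit.
Unset Printing Implicit Defensive.
Import GRing.Theory.
Local Open Scope ring_scope.

(* A linear map L -> End(V) is encoded as a bilinear map L -> V -> V. *)
Record lieRepPair (K : fieldType) (L V : lmodType K) := LieRepPair {
  lie_br : {bilinear L -> L -> L};
  lie_rep : {bilinear L -> V -> V};
  lie_br_alt : forall x, lie_br x x = 0;
  lie_br_jacobi : forall x y z,
    lie_br (lie_br x y) z + lie_br (lie_br y z) x + lie_br (lie_br z x) y = 0;
  lie_rep_br : forall x y v,
    lie_rep (lie_br x y) v
      = lie_rep x (lie_rep y v) - lie_rep y (lie_rep x v)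
}.

Definition lie_O_operator (K : fieldType) (L V : lmodType K)
    (P : lieRepPair L V) (T : {linear V -> L}) : Prop :=
  forall u v : V,
    lie_br P (T u) (T v) = T (lie_rep P (T u) v - lie_rep P (T v) u).

Definition trilinear (K : fieldType) (U1 U2 U3 W : lmodType K)
    (f : U1 -> U2 -> U3 -> W) : Prop :=
  [/\ forall y z, linear (fun x => f x y z),
      forall x z, linear (fun y => f x y z)
    & forall x y, linear (f x y)].

Record is_lts (K : fieldType) (L : lmodType K) (br : L -> L -> L -> L) : Prop :=
  IsLts {
  lts_trilinear : trilinear br;
  lts_skew : forall x y z, br x y z = - br y x z;
  lts_cyclic : forall x y z, br x y z + br y z x + br z x y = 0;
  lts_derivation : forall x y z t e,
    br x y (br z t e)
      = br (br x y z) t e + br z (br x y t) e + br z t (br x y e)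
}.

Definition lts_D (K : fieldType) (L V : lmodType K) (theta : L -> L -> V -> V)
    (x y : L) (v : V) : V :=
  theta y x v - theta x y v.

(* Yamaguti's axioms, evaluated at v : V; a bilinear map theta from L x L to
   End(V) is encoded as a trilinear map L -> L -> V -> V. *)
Record is_lts_rep (K : fieldType) (L V : lmodType K) (br : L -> L -> L -> L)
    (theta : L -> L -> V -> V) : Prop := IsLtsRep {
  lts_rep_trilinear : trilinear theta;
  lts_rep_theta : forall x y z t v,
    theta z t (theta x y v) - theta y t (theta x z v)
      - theta x (br y z t) v + lts_D theta y z (theta x t v) = 0;
  lts_rep_D : forall x y z t v,
    theta z t (lts_D theta x y v) - lts_D theta x y (theta z t v)
      + theta (br x y z) t v + theta z (br x y t) v = 0
}.

Record ltsRepPair (K : fieldType) (L V : lmodType K) := LtsRepPair {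
  lts_br : L -> L -> L -> L;
  lts_theta : L -> L -> V -> V;
  lts_br_lts : is_lts lts_br;
  lts_theta_rep : is_lts_rep lts_br lts_theta
}.

Definition lts_O_operator (K : fieldType) (L V : lmodType K)
    (P : ltsRepPair L V) (T : {linear V -> L}) : Prop :=
  forall u v w : V,
    lts_br P (T u) (T v) (T w)
      = T (lts_D (lts_theta P) (T u) (T v) w
           + lts_theta P (T v) (T w) u - lts_theta P (T u) (T w) v).

Section LtsOfLie.
Variables (K : fieldType) (L V : lmodType K) (P : lieRepPair L V).

Definition br_of_lie (x y z : L) : L := lie_br P (lie_br P x y) z.

Definition theta_of_rep (x y : L) (v : V) : V := lie_rep P y (lie_rep P x v).

Lemma lie_br_skew x y : lie_br P x y = - lie_br P y x.
Proof.
have := lie_br_alt P (x + y).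
rewrite linearDl !linearDr !lie_br_alt add0r addr0 => /eqP.
by rewrite addr_eq0 => /eqP.
Qed.

Lemma lie_br_der x y z :
  lie_br P x (lie_br P y z)
    = lie_br P (lie_br P x y) z + lie_br P y (lie_br P x z).
Proof.
have /eqP := lie_br_jacobi P x y z.
rewrite addrAC addr_eq0 => /eqP jac.
rewrite (lie_br_skew x (lie_br P y z)) -jac; congr (_ + _).
by rewrite (lie_br_skew z x) linearNl -lie_br_skew.
Qed.

Lemma br_of_lie_lts : is_lts br_of_lie.
Proof.
rewrite /br_of_lie; split.
- split=> [y z a u v|x z a u v|x y a u v].
  + by rewrite !linearPl.
  + by rewrite linearPr linearPl.
  + by rewrite linearPr.
- by move=> x y z; rewrite (lie_br_skew x) linearNl.
- by move=> x y z; apply: lie_br_jacobi.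
- move=> x y z t e; set d := lie_br P x y.
  by rewrite lie_br_der (lie_br_der d z t) linearDl.
Qed.

Lemma theta_of_rep_D x y v : lts_D theta_of_rep x y v = lie_rep P (lie_br P x y) v.
Proof. by rewrite lie_rep_br. Qed.

Lemma theta_of_rep_lts : is_lts_rep br_of_lie theta_of_rep.
Proof.
split.
- split=> [y z a u v|x z a u v|x y a u v]; rewrite /theta_of_rep.
  + by rewrite linearPl linearPr.
  + by rewrite linearPl.
  + by rewrite !linearPr.
- move=> x y z t v; rewrite theta_of_rep_D /theta_of_rep /br_of_lie.
  rewrite lie_rep_br (lie_rep_br P y z (lie_rep P x v)) linearBr.
  rewrite (opprB (lie_rep P (lie_br P y z) _)) -addrA subrK.
  by rewrite subrKA subrr.
- move=> x y z t v; rewrite !theta_of_rep_D /theta_of_rep /br_of_lie.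
  set d := lie_br P x y; rewrite !(lie_rep_br P d) linearBr.
  by rewrite addrAC !subrKA subrr.
Qed.

Definition ltsRepPair_of_lie : ltsRepPair L V :=
  LtsRepPair br_of_lie_lts theta_of_rep_lts.

End LtsOfLie.

(* Main.v *)
Require Import Defs.
From mathcomp Require Import all_boot all_algebra.
Import GRing.Theory.
Local Open Scope ring_scope.

(** Put [s = rho(Tu)v - rho(Tv)u], so that [[Tu,Tv] = Ts].  The triple bracket
    [[[Tu,Tv],Tw]] is then the binary bracket of the two images [Ts] and [Tw],
    and a second use of the O-operator identity shows that it is the image
    under [T] of [rho(Ts)w - rho(Tw)s].  The first term is
    [rho([Tu,Tv])w = D(Tu,Tv)w], because the operator [D] attached to
    [theta_rho] is the commutator of [rho(Tu)] and [rho(Tv)]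
    ([theta_of_rep_D]); expanding [s] in the second one by linearity of
    [rho(Tw)] gives the two remaining [theta_rho] terms. *)

Theorem proposition6p6 (K : fieldType) (charK : [pchar K] =i pred0)
    (L V : lmodType K) (P : lieRepPair L V) (T : {linear V -> L}) :
  lie_O_operator P T -> lts_O_operator (ltsRepPair_of_lie P) T.
Proof.
move=> OT u v w /=; rewrite theta_of_rep_D /br_of_lie /theta_of_rep.
rewrite -addrA -[X in _ + X]opprB -linearBr.
(* The bracket [Tu,Tv] on both sides becomes Ts. *)
by rewrite OT OT.
Qed.
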